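(* Let $X_1,X_2,\dots$ be i.i.d. real-valued random variables with common distribution $F$, let $f_c:\mathbb{R}^2\to\mathbb{R}$ be Borel measurable with $f_c(x,y)=f_c(y,x)$, let $B\subset\mathbb{R}$ be a Borel set, and fix a real number $w$. For each $n$, consider the random graph on vertices $1,\dots,n$ in which $i\neq j$ are adjacent iff $f_c(X_i,X_j)\in B$. For vertex $i$, let $D_n(i)$ be its degree and $T_n(i)$ the number of triangles containing $i$, and define the local clustering coefficient $$C_n(i)=\frac{T_n(i)}{\binom{D_n(i)}{2}}I_{\{D_n(i)\ge 2\}}+w\,I_{\{D_n(i)\in\{0,1\}\}},$$ and the global clustering coefficient $C_n=\frac1n\sum_{i=1}^n C_n(i)$. Let $h_D(x,y)=I_B(f_c(x,y))$, $h_T(x,y,z)=I_B(f_c(x,y))I_B(f_c(y,z))I_B(f_c(z,x))$, $E_D(x)=\int h_D(x,y)F(dy)$, $E_T(x)=\iint h_T(x,y,z)F(dy)F(dz)$, and $$C(1)=\frac{E_T(X_1)}{E_D(X_1)^2}I_{\{E_D(X_1)>0\}}+w\,I_{\{E_D(X_1)=0\}}.$$ Then $C_n\to\mathbb{E}[C(1)]$ almost surely as $n\to\infty$.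
   Context: $I_A$ denotes the indicator function of the set $A$. *)

(* Defs.v *)
From HB Require Import structures.
From mathcomp Require Import all_boot all_order all_algebra finmap.
From mathcomp Require Import all_classical all_reals all_analysis.
Set Implicit Arguments. Unset Strict Implicit. Unset Printing Implicit Defensive.
Import Order.TTheory GRing.Theory Num.Theory.
Import numFieldNormedType.Exports.
Local Open Scope classical_set_scope.
Local Open Scope ring_scope.

Section Defs.
Context {d : measure_display} {T : measurableType d} {R : realType}.

Definition mutually_independent (P : probability T R) (X : nat -> T -> R) : Prop :=
  forall (J : {fset nat}) (A : nat -> set R),
    (forall j, j \in J -> measurable (A j)) ->
    P (\bigcap_(j in [set` J]) (X j @^-1` A j)) =
    (\prod_(j <- J) P (X j @^-1` A j))%E.

Definition identically_distributed (P : probability T R) (X : nat -> T -> R) : Prop :=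
  forall i (A : set R), measurable A -> P (X i @^-1` A) = P (X 0%N @^-1` A).

Definition iid (P : probability T R) (X : nat -> T -> R) : Prop :=
  mutually_independent P X /\ identically_distributed P X.
End Defs.

Section Graph.
Context {R : realType}.
Variables (fc : R -> R -> R) (B : set R).

Definition adj (x y : R) : bool := fc x y \in B.

(* vertices are 0, ..., n-1; v i is the value X_i(omega) *)
Definition degree (n : nat) (v : nat -> R) (i : nat) : nat :=
  (\sum_(j < n | (j : nat) != i) adj (v i) (v j))%N.

Definition triangles (n : nat) (v : nat -> R) (i : nat) : nat :=
  (\sum_(j < n) \sum_(k < n | [&& (j : nat) != i, (k : nat) != i & (j < k)%N])
     [&& adj (v i) (v j), adj (v j) (v k) & adj (v k) (v i)])%N.

Definition local_cc (w : R) (n : nat) (v : nat -> R) (i : nat) : R :=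
  (triangles n v i)%:R / ('C(degree n v i, 2))%:R * (2 <= degree n v i)%N%:R
  + w * (degree n v i \in [:: 0%N; 1%N])%:R.

Definition global_cc (w : R) (n : nat) (v : nat -> R) : R :=
  n%:R^-1 * \sum_(i < n) local_cc w n v i.

Definition hD (x y : R) : R := (adj x y)%:R.
Definition hT (x y z : R) : R := (adj x y)%:R * (adj y z)%:R * (adj z x)%:R.

Definition ED (F : {measure set R -> \bar R}) (x : R) : R :=
  Rintegral F setT (fun y => hD x y).
Definition ET (F : {measure set R -> \bar R}) (x : R) : R :=
  Rintegral F setT (fun y => Rintegral F setT (fun z => hT x y z)).

Definition C1 (F : {measure set R -> \bar R}) (w : R) (x : R) : R :=
  ET F x / (ED F x) ^+ 2 * ((0 < ED F x)%R : bool)%:R + w * ((ED F x == 0)%R : bool)%:R.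
End Graph.

(* Main.v *)
Require Import Defs.
From HB Require Import structures.
From mathcomp Require Import all_boot all_order all_algebra finmap.
From mathcomp Require Import all_classical all_reals all_analysis.
From mathcomp Require Import measurable_realfun ring lra zify.
Import Order.TTheory GRing.Theory Num.Theory.
Import numFieldNormedType.Exports.
Local Open Scope classical_set_scope.
Local Open Scope ring_scope.

(* For a bounded kernel phi with [int phi(x, y, z) F(dz) = 0], the mean square
   over i, j < n of [n^-1 sum_k phi(X_i, X_j, X_k)] has expectation O(1/n),
   because E[phi(X_i, X_j, X_k) phi(X_i, X_j, X_l)] vanishes unless l is one of
   i, j, k.  This is summable along n = m^2, and between consecutive squares the
   mean square increases by at most O(1/m); hence it tends to 0 almost surely.
   Applied to h_D - E_D, to h_T - int h_T dF and to the remaining integration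
   defining E_T, this shows that D_n(i)/n and 2 T_n(i)/n^2 are close to
   E_D(X_i) and E_T(X_i) on average over i.  Consequently C_n(i) is close to
   C(X_i) on average over the i with E_D(X_i) > 1/(m+1).  The vertices with
   E_D(X_i) = 0 are almost surely isolated, so C_n(i) = w = C(X_i) for them,
   and those with 0 < E_D(X_i) <= 1/(m+1) have an asymptotic frequency that
   vanishes as m grows.  The strong law for C(X_i) concludes. *)

(** * Integrability of bounded functions and elementary counting *)

Lemma probability_bounded_integrable {R : realType} d (T : measurableType d)
    (Q : probability T R) (f : T -> R) (K : R) :
  measurable_fun setT f -> (forall x, `|f x| <= K) ->
  Q.-integrable setT (EFin \o f).
Proof.
move=> mf fK; apply: measurable_bounded_integrable => //.
  by rewrite (le_lt_trans (probability_le1 _ _)) ?ltry.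
by exists K; split; [exact: num_real|move=> M KM x _; exact: le_trans (fK x) (ltW KM)].
Qed.

Lemma sum_nat_eq (n m : nat) : (\sum_(k < n) (k == m :> nat) <= 1)%N.
Proof.
have [nm|nm] := leqP n m.
  by rewrite big1// => l _; case: eqVneq => // il; move: (ltn_ord l); rewrite il ltnNge nm.
rewrite (bigD1 (Ordinal nm))//= eqxx big1// => l /eqP li.
by case: eqVneq => // il; case: li; exact/val_inj.
Qed.

Lemma double_bin2 m : (2 * 'C(m, 2) = m * m.-1)%N.
Proof. by rewrite mulnC (bin_ffact m 2) ffactnS ffactn1. Qed.

(** * Independence of one variable from the others *)

Section independence.
Context {d : measure_display} {T : measurableType d} {R : realType}.
Variables (P : probability T R) (X : nat -> {RV P >-> R}).
Hypothesis indepX : mutually_independent P (fun i => X i).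

(** A pi-system generating the sigma-algebra of all the variables other than [X l]. *)
Definition cylinders_avoiding (l : nat) : set (set T) :=
  [set E | exists (J : {fset nat}) (A : nat -> set R),
    [/\ l \notin J, forall j, measurable (A j) &
        E = \bigcap_(j in [set` J]) (X j @^-1` A j)]].

Lemma measurable_preimage_RV (Y : {RV P >-> R}) (A : set R) :
  measurable A -> measurable (Y @^-1` A).
Proof. by move=> mA; rewrite -[_ @^-1` _]setTI; exact: (measurable_funP Y). Qed.

Lemma measurable_cylinder l : cylinders_avoiding l `<=` measurable.
Proof.
move=> _ [J [A [_ mA ->]]].
apply: fin_bigcap_measurable => [|j _]; first exact: finite_fset.
exact: measurable_preimage_RV.
Qed.

Lemma cylinders_setI l : setI_closed (cylinders_avoiding l).
Proof.
move=> _ _ [J [A [lJ mA ->]]] [K [B [lK mB ->]]].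
exists (J `|` K)%fset, (fun j => (if j \in J then A j else setT) `&`
                                (if j \in K then B j else setT)).
split.
- by rewrite in_fsetU negb_or lJ lK.
- by move=> j; apply: measurableI; case: ifP.
- rewrite predeqE => t; split.
    move=> [tA tB] j /= _; split.
      by case: ifP => // jJ; exact: tA.
    by case: ifP => // jK; exact: tB.
  move=> tAB; split => j /= jJ.
    have : j \in (J `|` K)%fset by rewrite in_fsetU jJ.
    by move=> /tAB[/=]; rewrite jJ.
  have : j \in (J `|` K)%fset by rewrite in_fsetU jJ orbT.
  by move=> /tAB[/= _]; rewrite jJ.
Qed.

(** Adjoining [l] to the index set, with [B] as its event, gives another finite intersection; as [l]
    is not in [J], its factor splits off the product. *)
Lemma cylinder_indep l (E : set T) (B : set R) :
  cylinders_avoiding l E -> measurable B ->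
  P (E `&` X l @^-1` B) = (P E * P (X l @^-1` B))%E.
Proof.
move=> [J [A [lJ mA ->]]] mB.
pose A' j := if j == l then B else A j.
have mA' j : measurable (A' j) by rewrite /A'; case: ifP.
have A'J j : j \in J -> A' j = A j.
  by rewrite /A'; case: eqVneq => // ->; rewrite (negbTE lJ).
transitivity (P (\bigcap_(j in [set` (l |` J)%fset]) (X j @^-1` A' j))).
  congr (P _); rewrite predeqE => t; split.
    move=> [tA tB] j /=; rewrite in_fset1U => /orP[/eqP ->|jJ].
      by rewrite /A' eqxx.
    by rewrite A'J//; exact: tA.
  move=> tA; split.
    by move=> j /= jJ; have /= := tA j; rewrite in_fset1U jJ orbT A'J//; exact.
  by have /= := tA l; rewrite in_fset1U eqxx /A' eqxx; exact.
rewrite (indepX _ _ (fun j _ => mA' j)) big_fsetU1//= muleC.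
rewrite (indepX _ _ (fun j _ => mA j)) /A' eqxx; congr (_ * _)%E.
rewrite big_seq [RHS]big_seq; apply: eq_bigr => j jJ.
by rewrite -/(A' j) A'J.
Qed.

(** For fixed [B], both sides are finite measures in [E] that agree on a pi-system, hence on the
    sigma-algebra that it generates. *)
Lemma sigma_cylinder_indep l (E : set T) (B : set R) :
  <<s cylinders_avoiding l >> E -> measurable B ->
  P (E `&` X l @^-1` B) = (P E * P (X l @^-1` B))%E.
Proof.
move=> sE mB.
have mXB := measurable_preimage_RV (X l) _ mB.
have PB0 : 0 <= fine (P (X l @^-1` B)) by exact: fine_ge0.
have -> : P (E `&` X l @^-1` B) = mrestr P mXB E by [].
have mscaleE A : (P A * P (X l @^-1` B))%E = mscale (NngNum PB0) P A.
  by rewrite /mscale/= fineK ?fin_num_measure// muleC.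
rewrite mscaleE.
apply: (g_sigma_algebra_measure_unique (cylinders_avoiding l) _ (fun=> setT)
   _ _ (mrestr P mXB) (mscale (NngNum PB0) P)) => //.
- exact: measurable_cylinder.
- move=> _; exists fset0, (fun=> setT); split => //.
  by rewrite predeqE => t; split.
- by rewrite bigcup_const//; exists 0%N.
- exact: cylinders_setI.
- by move=> A lA; exact: eq_trans (cylinder_indep _ _ _ lA mB) (mscaleE A).
- move=> _; rewrite /mrestr.
  by rewrite (le_lt_trans (probability_le1 _ _)) ?ltry//; exact: measurableI.
Qed.

Let triple i j k (t : T) : R * R * R := (X i t, X j t, X k t).

Let measurable_triple i j k : measurable_fun setT (triple i j k).
Proof.
apply: measurable_fun_pair; last exact: measurable_funP.
by apply: measurable_fun_pair; exact: measurable_funP.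
Qed.

Lemma sigma_cylinder_preimage l i (A : set R) : i != l -> measurable A ->
  <<s cylinders_avoiding l >> (X i @^-1` A).
Proof.
move=> il mA; apply: sub_sigma_algebra; exists [fset i]%fset, (fun=> A); split=> //.
  by rewrite inE eq_sym.
rewrite predeqE => t; split => [tA j /=|/(_ i)]; last by rewrite /= inE; exact.
by rewrite inE => /eqP ->.
Qed.

(** Each of the three variables is measurable on [T] equipped with the sigma-algebra generated by
    the cylinders, hence so is their triple; thus [C] may be any measurable set and not only a
    rectangle. *)
Lemma sigma_cylinder_triple l i j k (C : set (R * R * R)) :
  i != l -> j != l -> k != l -> measurable C ->
  <<s cylinders_avoiding l >> (triple i j k @^-1` C).
Proof.
move=> il jl kl mC.
pose Tl := g_sigma_algebraType (cylinders_avoiding l).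
have mX m : m != l -> measurable_fun setT (X m : Tl -> R).
  by move=> ml _ B mB; rewrite setTI; exact: sigma_cylinder_preimage.
have m3 : measurable_fun setT (triple i j k : Tl -> R * R * R).
  apply: measurable_fun_pair; last exact: mX.
  by apply: measurable_fun_pair; exact: mX.
by have := m3 measurableT C mC; rewrite setTI.
Qed.

Hypothesis identX : identically_distributed P (fun i => X i).
Local Notation F := (distribution P (X 0%N)).

(* The indices i, j, k need not be distinct. *)
Lemma integral_triple_indep (b : R * R * R * R -> R) (K : R) l i j k :
  i != l -> j != l -> k != l ->
  measurable_fun setT b -> (forall z, `|b z| <= K) ->
  (\int[P]_t (b (X i t, X j t, X k t, X l t))%:E =
   \int[P]_t \int[F]_y (b (X i t, X j t, X k t, y))%:E)%E.
Proof.
move=> il jl kl mb bK.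
have m3 := measurable_triple i j k.
have m4 : measurable_fun setT (fun t => (triple i j k t, X l t)).
  by apply: measurable_fun_pair => //; exact: measurable_funP.
pose V := mfun_Sub (mem_set m3) : {RV P >-> (R * R * R)%type}.
pose W := mfun_Sub (mem_set m4) : {RV P >-> (R * R * R * R)%type}.
(* The triple is independent of [X l], which has law [F], so the joint law and the product law agree
   on rectangles and therefore everywhere. Fubini then integrates out [X l]. *)
have WE C : measurable C -> (distribution P V \x F)%E C = distribution P W C.
  apply: product_measure_unique => A B mA mB.
  rewrite /distribution /pushforward /=.
  have := sigma_cylinder_indep l (triple i j k @^-1` A) B
    (sigma_cylinder_triple _ _ _ _ _ il jl kl mA) mB.
  rewrite (identX l B mB) => <-; congr (P _).
transitivity (\int[distribution P W]_z (b z)%:E)%E.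
  rewrite integral_distribution//=; first exact/measurable_EFinP.
  apply: (probability_bounded_integrable _ _ P (b \o W) K) => [|t]; last exact: bK.
  exact: measurableT_comp.
rewrite -(eq_measure_integral _ (fun A mA _ => WE A mA)).
have bprod : (distribution P V \x F)%E.-integrable setT (EFin \o b).
  apply: measurable_bounded_integrable => //.
  - apply: (@le_lt_trans _ _ (distribution P W setT)); first last.
      by rewrite (le_lt_trans (probability_le1 _ _)) ?ltry.
    by rewrite le_eqVlt; apply/orP; left; apply/eqP; exact: WE.
  - by exists K; split; [exact: num_real|move=> M KM z _; exact: le_trans (bK _) (ltW KM)].
have mbF := measurable_fubini_F bprod.
rewrite -(integral12_prod_meas1 bprod) integral_distribution//.
apply/integrableP; split; first exact: measurableT_comp.
have /integrableP[_] := integrable_fubini_F bprod.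
by rewrite ge0_integral_distribution//; exact: measurableT_comp.
Qed.

End independence.

(** * Averages of triple arrays *)

Section sums.
Context {R : realType}.

Definition sum_sqr (a : nat -> nat -> nat -> R) (n : nat) : R :=
  \sum_(i < n) \sum_(j < n) (\sum_(k < n) a i j k) ^+ 2.

(** The factor n^-4 combines n^-2 for averaging over i, j with n^-2 from squaring the mean over
    k. *)
Definition avg_sqr (a : nat -> nat -> nat -> R) (n : nat) : R :=
  (n%:R ^+ 4)^-1 * sum_sqr a n.

Definition avg_abs (a : nat -> nat -> nat -> R) (n : nat) : R :=
  (n%:R ^+ 2)^-1 * \sum_(i < n) \sum_(j < n) `|n%:R^-1 * \sum_(k < n) a i j k|.

Lemma ler_norm_sum_ord (n : nat) (f : nat -> R) (K : R) :
  (forall i, `|f i| <= K) -> `|\sum_(i < n) f i| <= K * n%:R.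
Proof.
move=> fK; apply: (le_trans (ler_norm_sum _ (fun i : 'I_n => f i) _)).
apply: le_trans (ler_sum _ (fun (i : 'I_n) _ => fK i)) _.
by rewrite sumr_const card_ord mulr_natr.
Qed.

Lemma ler_sum_ord (n : nat) (f : nat -> R) (K : R) :
  (forall i, (i < n)%N -> f i <= K) -> \sum_(i < n) f i <= K * n%:R.
Proof.
move=> fK; apply: le_trans (ler_sum _ (fun (i : 'I_n) _ => fK i (ltn_ord i))) _.
by rewrite sumr_const card_ord mulr_natr.
Qed.

Lemma sum_sqr_ge0 a n : 0 <= sum_sqr a n.
Proof. by apply: sumr_ge0 => i _; apply: sumr_ge0 => j _; exact: sqr_ge0. Qed.

Lemma avg_sqr_ge0 a n : 0 <= avg_sqr a n.
Proof. by rewrite mulr_ge0 ?sum_sqr_ge0// invr_ge0 exprn_ge0. Qed.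

(** Each of the n^2 old squares grows by at most K^2 (2n + 1), and each of the 2n + 1 new pairs (i,
    j) adds at most K^2 (n + 1)^2. The total is exactly the increment for the constant array K, so
    the bound telescopes. *)
Lemma sum_sqrS a n (K : R) : (forall i j k, `|a i j k| <= K) ->
  sum_sqr a n.+1 <= sum_sqr a n + K ^+ 2 * (n.+1%:R ^+ 4 - n%:R ^+ 4).
Proof.
move=> aK.
have K0 : 0 <= K by apply: le_trans (normr_ge0 _) (aK 0%N 0%N 0%N).
have big_sq i j m : (\sum_(k < m) a i j k) ^+ 2 <= K ^+ 2 * m%:R ^+ 2.
  rewrite -real_normK ?num_real// -exprMn lerXn2r ?nnegrE ?mulr_ge0//.
  exact: ler_norm_sum_ord.
have step i j : (\sum_(k < n.+1) a i j k) ^+ 2 <=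
    (\sum_(k < n) a i j k) ^+ 2 + K ^+ 2 * (2 * n%:R + 1).
  rewrite big_ord_recr/= sqrrD -addrA lerD2l mulrDr mulr1 lerD//; last first.
    by rewrite -real_normK ?num_real// lerXn2r ?nnegrE.
  apply: le_trans (ler_norm _) _; rewrite normrMn normrM.
  rewrite [leRHS](_ : _ = (K * n%:R * K) *+ 2); last by ring.
  rewrite lerMn2r/=; apply: ler_pM => //.
  exact: (ler_norm_sum_ord _ (fun k => a i j k)).
rewrite /sum_sqr big_ord_recr/=.
have row i : \sum_(j < n.+1) (\sum_(k < n.+1) a i j k) ^+ 2 <=
    \sum_(j < n) (\sum_(k < n) a i j k) ^+ 2
    + (K ^+ 2 * (2 * n%:R + 1) * n%:R + K ^+ 2 * n.+1%:R ^+ 2).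
  rewrite big_ord_recr/= addrA lerD//.
  apply: le_trans (ler_sum _ (fun (j : 'I_n) _ => step i j)) _.
  by rewrite big_split/= sumr_const card_ord -[_ *+ n]mulr_natr.
  exact: big_sq.
apply: (@le_trans _ _ (\sum_(i < n) \sum_(j < n) (\sum_(k < n) a i j k) ^+ 2 +
   (K ^+ 2 * (2 * n%:R + 1) * n%:R + K ^+ 2 * n.+1%:R ^+ 2) * n%:R +
   K ^+ 2 * n.+1%:R ^+ 2 * n.+1%:R)).
  apply: lerD.
    apply: le_trans (ler_sum _ (fun (i : 'I_n) _ => row i)) _.
    by rewrite big_split/= sumr_const card_ord -[_ *+ n]mulr_natr.
  by apply: (ler_sum_ord _ (fun j => (\sum_(k < n.+1) a n j k) ^+ 2)) => j _.
rewrite -addrA lerD2l -natr1 le_eqVlt; apply/orP; left; apply/eqP; ring.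
Qed.

Lemma sum_sqr_le a n m (K : R) : (forall i j k, `|a i j k| <= K) ->
  (m <= n)%N -> sum_sqr a n <= sum_sqr a m + K ^+ 2 * (n%:R ^+ 4 - m%:R ^+ 4).
Proof.
move=> aK /subnKC <-; elim: (n - m)%N => [|p IH].
  by rewrite addn0 subrr mulr0 addr0.
rewrite addnS; apply: le_trans (sum_sqrS _ _ _ aK) _.
apply: le_trans (lerD IH (lexx _)) _; rewrite -addrA -mulrDr.
by rewrite le_eqVlt; apply/orP; left; apply/eqP; ring.
Qed.

(** With N = (m + 1)^2, factor n^4 - N^4 = (n - N)(n + N)(n^2 + N^2). The factors are at most 3(m +
    1), 2n and 2n^2, whence the 12; dividing by n^4 and using N <= n leaves 1/(m + 1). *)
Lemma avg_sqr_interpolate a m n (K : R) : (forall i j k, `|a i j k| <= K) ->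
  (m.+1 ^ 2 <= n < m.+2 ^ 2)%N ->
  avg_sqr a n <= avg_sqr a (m.+1 ^ 2) + 12 * K ^+ 2 * m.+1%:R^-1.
Proof.
move=> aK /andP[mn nm].
set N := (m.+1 ^ 2)%N in mn *.
have N0 : (0 < N)%N by rewrite expn_gt0.
have n0 : (0 < n)%N by exact: leq_trans mn.
have nr0 : 0 < n%:R :> R by rewrite ltr0n.
have Nr0 : 0 < N%:R :> R by rewrite ltr0n.
have Nn : N%:R <= n%:R :> R by rewrite ler_nat.
have r1 : n%:R - N%:R <= 3 * m.+1%:R :> R.
  rewrite lerBlDr -natrM -natrD ler_nat /N.
  by move: nm; rewrite !expnS !expn0 !muln1; lia.
apply: (@le_trans _ _ ((n%:R ^+ 4)^-1 * (sum_sqr a N + K ^+ 2 * (n%:R ^+ 4 - N%:R ^+ 4)))).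
  by rewrite ler_wpM2l ?invr_ge0 ?exprn_ge0//; exact: sum_sqr_le.
rewrite mulrDr lerD//.
  by rewrite ler_wpM2r ?sum_sqr_ge0// lef_pV2 ?posrE ?exprn_gt0// lerXn2r ?nnegrE.
have N2 : N%:R = m.+1%:R ^+ 2 :> R by rewrite /N natrX.
rewrite [leRHS](_ : _ = K ^+ 2 * (12 * m.+1%:R^-1)); last by ring.
rewrite mulrCA ler_wpM2l ?sqr_ge0//.
rewrite mulrC ler_pdivrMr ?exprn_gt0//.
have m0 : 0 < m.+1%:R :> R by [].
have -> : n%:R ^+ 4 - N%:R ^+ 4 =
    (n%:R - N%:R) * ((n%:R + N%:R) * (n%:R ^+ 2 + N%:R ^+ 2)) :> R by ring.
apply: (@le_trans _ _ (3 * m.+1%:R * (2 * n%:R * (2 * n%:R ^+ 2)))).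
  apply: ler_pM => //.
  - by rewrite subr_ge0.
  - apply: ler_pM; [by rewrite addr_ge0 ?ler0n|by rewrite addr_ge0 ?sqr_ge0|by move: Nn; lra|].
    have : N%:R ^+ 2 <= n%:R ^+ 2 :> R by rewrite lerXn2r ?nnegrE ?ler0n.
    by lra.
rewrite [leRHS](_ : _ = m.+1%:R^-1 * n%:R * (12 * n%:R ^+ 3)); last by ring.
rewrite [leLHS](_ : _ = m.+1%:R * (12 * n%:R ^+ 3)); last by ring.
rewrite ler_wpM2r ?mulr_ge0 ?exprn_ge0//.
by rewrite ler_pdivlMl// -expr2 -N2.
Qed.

Lemma cvg_avg_sqr a (K : R) : (forall i j k, `|a i j k| <= K) ->
  (fun m => avg_sqr a (m.+1 ^ 2)) @ \oo --> (0 : R) ->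
  avg_sqr a @ \oo --> (0 : R).
Proof.
move=> aK a0.
have b0 : (fun m => avg_sqr a (m.+1 ^ 2) + 12 * K ^+ 2 * m.+1%:R^-1) @ \oo --> (0 : R).
  rewrite -[X in _ --> X]addr0; apply: cvgD => //.
  rewrite -[X in _ --> X](mulr0 (12 * K ^+ 2)); apply: cvgMr.
  exact: cvg_harmonic.
apply/cvgrPdist_lt => e e0.
move/cvgrPdist_lt : b0 => /(_ e e0)[M _ bM].
exists (M.+1 ^ 2)%N => //= n Mn.
have [m /andP[mn nm]] : exists m, (m.+1 ^ 2 <= n < m.+2 ^ 2)%N.
  have n0 : (0 < n)%N by apply: leq_trans Mn; rewrite expn_gt0.
  elim: n n0 {Mn} => // -[_ _|n IH _]; first by exists 0%N.
  have [m /andP[mn nm]] := IH isT.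
  case: (ltnP n.+2 (m.+2 ^ 2)%N) => nm'; first by exists m; rewrite nm' andbT ltnW.
  by exists m.+1; rewrite nm'/=; move: nm; rewrite !expnS !expn0 !muln1; lia.
have Mm : (M <= m)%N.
  rewrite leqNgt; apply/negP => mM.
  have : (m.+2 ^ 2 <= n)%N by rewrite (leq_trans _ Mn)// leq_exp2r.
  by rewrite leqNgt nm.
have := bM m Mm; rewrite !sub0r !normrN.
rewrite !ger0_norm ?avg_sqr_ge0//; last first.
  by rewrite addr_ge0 ?avg_sqr_ge0// mulr_ge0// mulr_ge0// sqr_ge0.
by apply: le_lt_trans; apply: avg_sqr_interpolate => //; rewrite mn.
Qed.

(** Pointwise |u| <= e + u^2/e: the first term covers |u| <= e and the second covers |u| > e. This
    serves in place of Cauchy-Schwarz. *)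
Lemma avg_abs_le a n (e : R) : 0 < e -> avg_abs a n <= e + avg_sqr a n / e.
Proof.
move=> e0.
have abs_le (u : R) : `|u| <= e + u ^+ 2 / e.
  have [ue|eu] := leP `|u| e; first by rewrite ler_wpDr// divr_ge0 ?sqr_ge0 ?ltW.
  rewrite ler_wpDl ?(ltW e0)// ler_pdivlMr// -real_normK ?num_real// expr2.
  by rewrite ler_wpM2l// ltW.
have [->|n0] := posnP n.
  by rewrite /avg_abs big_ord0 mulr0 addr_ge0 ?(ltW e0)// divr_ge0 ?avg_sqr_ge0 ?(ltW e0).
have nr0 : 0 < n%:R :> R by rewrite ltr0n.
rewrite /avg_abs ler_pdivrMl ?exprn_gt0//.
apply: (@le_trans _ _ (\sum_(i < n) \sum_(j < n)
   (e + (n%:R ^+ 2)^-1 / e * (\sum_(k < n) a i j k) ^+ 2))).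
  apply: ler_sum => i _; apply: ler_sum => j _.
  apply: le_trans (abs_le _) _; rewrite exprMn exprVn le_eqVlt; apply/orP; left.
  by apply/eqP; ring.
under eq_bigr do rewrite big_split/= -mulr_sumr sumr_const card_ord.
rewrite big_split/= -mulr_sumr sumr_const card_ord /avg_sqr -/(sum_sqr a n).
rewrite -[e *+ n]mulr_natr -[_ *+ n]mulr_natr le_eqVlt; apply/orP; left; apply/eqP; field.
by rewrite !gt_eqF.
Qed.

Lemma cvg_avg_abs a : avg_sqr a @ \oo --> (0 : R) -> avg_abs a @ \oo --> (0 : R).
Proof.
move=> a0; apply/cvgrPdist_lt => e e0.
have e20 : 0 < e / 2 by rewrite divr_gt0.
(* Once [avg_sqr] is below (e/2)^2, the second term of [avg_abs_le], taken at e/2, is below e/2. *)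
have ee : 0 < (e / 2) ^+ 2 by rewrite exprn_gt0.
move/cvgrPdist_lt : a0 => /(_ _ ee)[M _ aM].
exists M => // n /aM; rewrite !sub0r !normrN ger0_norm ?avg_sqr_ge0// => an.
rewrite ger0_norm; last first.
  by rewrite mulr_ge0 ?invr_ge0 ?exprn_ge0//; do 2 apply: sumr_ge0 => ? _.
apply: le_lt_trans (avg_abs_le _ _ _ e20) _.
by rewrite [ltRHS]splitr ltrD2l ltr_pdivrMr// -expr2.
Qed.

End sums.

(** * Almost sure decay of averages of a centred kernel *)

Section triple_averages.
Context {d : measure_display} {T : measurableType d} {R : realType}.
Variables (P : probability T R) (X : nat -> {RV P >-> R}).
Hypothesis iidX : iid P (fun i => X i).
Local Notation F := (distribution P (X 0%N)).

Variables (phi : R -> R -> R -> R) (K : R).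
Hypothesis mphi : measurable_fun setT (fun p : R * R * R => phi p.1.1 p.1.2 p.2).
Hypothesis phiK : forall x y z, `|phi x y z| <= K.
Hypothesis phi0 : forall x y, (\int[F]_z (phi x y z)%:E = 0)%E.

Let a (t : T) (i j k : nat) := phi (X i t) (X j t) (X k t).

Let K0 : 0 <= K. Proof. exact: le_trans (normr_ge0 _) (phiK 0 0 0). Qed.

Let ma i j k : measurable_fun setT (fun t => a t i j k).
Proof.
apply: (measurableT_comp mphi (g := fun t => (X i t, X j t, X k t))).
by apply: measurable_fun_pair => //; exact: measurable_fun_pair.
Qed.

Let maa i j k l : measurable_fun setT (fun t => a t i j k * a t i j l).
Proof. by apply: measurable_funM; exact: ma. Qed.

Let aaK i j k l t : `|a t i j k * a t i j l| <= K ^+ 2.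
Proof. by rewrite normrM expr2 ler_pM ?phiK. Qed.

Let aaint i j k l :
  P.-integrable setT (fun t => (a t i j k * a t i j l)%:E).
Proof. exact: probability_bounded_integrable (maa i j k l) (aaK i j k l). Qed.

(** Integrating out [X l] first, the factor with [X k] is a constant and the other factor has
    integral 0 by [phi0]. *)
Lemma integral_cross_terms i j k l : i != l -> j != l -> k != l ->
  (\int[P]_t (a t i j k * a t i j l)%:E = 0)%E.
Proof.
move=> il jl kl.
pose b (p : R * R * R * R) :=
  phi p.1.1.1 p.1.1.2 p.1.2 * phi p.1.1.1 p.1.1.2 p.2.
have mb : measurable_fun setT b.
  apply: measurable_funM; first exact: (measurableT_comp mphi measurable_fst).
  apply: (measurableT_comp mphi (g := fun p : R * R * R * R => (p.1.1, p.2))).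
  apply: measurable_fun_pair; last exact: measurable_snd.
  exact: (measurableT_comp measurable_fst measurable_fst).
have bK p : `|b p| <= K ^+ 2 by rewrite normrM expr2 ler_pM ?phiK.
have [indX idX] := iidX.
have := integral_triple_indep P X indX idX b (K ^+ 2) l i j k il jl kl mb bK.
rewrite /b/= -/(a _ _ _ _) => ->.
apply: integral0_eq => t _.
under eq_integral do rewrite EFinM.
rewrite integralZl//; first by rewrite phi0 mule0.
apply: (probability_bounded_integrable _ _ _ _ K) => //.
exact: (measurableT_comp mphi (pair1_measurable (X i t, X j t))).
Qed.

Lemma sum_indicator_le1 n (i : nat) : \sum_(l < n) (i == l)%:R <= 1 :> R.
Proof.
rewrite -natr_sum lern1; under eq_bigr do rewrite eq_sym.
exact: sum_nat_eq.
Qed.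

(** After expanding the square, for each k only the indices l equal to i, j or k survive: at most
    three terms, each bounded by K^2. *)
Lemma integral_sqr_sum_le n i j :
  (\int[P]_t ((\sum_(k < n) a t i j k) ^+ 2)%:E <= (3 * K ^+ 2 * n%:R)%:E)%E.
Proof.
have -> : (fun t => ((\sum_(k < n) a t i j k) ^+ 2)%:E) =
   (fun t => \sum_(k < n) \sum_(l < n) (a t i j k * a t i j l)%:E)%E.
  apply/funext => t; under [RHS]eq_bigr do rewrite sumEFin.
  by rewrite sumEFin expr2 mulr_suml; under eq_bigr do rewrite mulr_sumr.
rewrite integral_sum//; last by move=> k; exact: integrable_sum.
under eq_bigr do rewrite integral_sum//.
apply: (@le_trans _ _ (\sum_(k < n) \sum_(l < n)
    (K ^+ 2 * ((i == l)%:R + (j == l)%:R + (k == l :> nat)%:R))%:E)%E).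
  apply: lee_sum => k _; apply: lee_sum => l _.
  have [|] := boolP [|| i == l, j == l | k == l :> nat]; last first.
    rewrite !negb_or => /and3P[il jl kl].
    by rewrite integral_cross_terms// (negbTE il) (negbTE jl) (negbTE kl) !addr0 mulr0.
  move=> ijkl; apply: (@le_trans _ _ (\int[P]_t (K ^+ 2)%:E)%E).
    apply: le_integral => //.
      apply: (probability_bounded_integrable _ _ _ _ (K ^+ 2)) => // t.
      by rewrite ger0_norm ?sqr_ge0.
    by move=> t _; rewrite lee_fin (le_trans (ler_norm _)).
  rewrite integral_cst// [X in (_ * X)%E]probability_setT mule1 lee_fin ler_peMr ?sqr_ge0//.
  by rewrite -!natrD ler1n; move: ijkl; case: (i == l); case: (j == l); case: (k == l :> nat).
under eq_bigr do rewrite sumEFin.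
rewrite sumEFin lee_fin; apply: (ler_sum_ord _ (fun k => \sum_(l < n)
  (K ^+ 2 * ((i == l)%:R + (j == l)%:R + (k == l)%:R)))) => k _.
rewrite -mulr_sumr mulrC ler_wpM2r ?sqr_ge0// !big_split/=.
by have := sum_indicator_le1 n i; have := sum_indicator_le1 n j;
  have := sum_indicator_le1 n k; lra.
Qed.

Lemma integral_avg_sqr_le n : (0 < n)%N ->
  (\int[P]_t (avg_sqr (a t) n)%:E <= (3 * K ^+ 2 * n%:R^-1)%:E)%E.
Proof.
move=> n0; have nr0 : 0 < n%:R :> R by rewrite ltr0n.
have mS i j : measurable_fun setT (fun t => (\sum_(k < n) a t i j k) ^+ 2).
  by apply: measurable_funX; exact: measurable_sum.
have Sint i j : P.-integrable setT (fun t => ((\sum_(k < n) a t i j k) ^+ 2)%:E).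
  apply: (probability_bounded_integrable _ _ _ _ ((K * n%:R) ^+ 2)) => // t.
  rewrite normrX lerXn2r ?nnegrE ?mulr_ge0//.
  by apply: (ler_norm_sum_ord _ (fun k => a t i j k)) => k; exact: phiK.
under eq_integral do rewrite /avg_sqr EFinM.
have WE t : (sum_sqr (a t) n)%:E =
    (\sum_(i < n) \sum_(j < n) ((\sum_(k < n) a t i j k) ^+ 2)%:E)%E.
  by under eq_bigr do rewrite sumEFin; rewrite sumEFin.
rewrite ge0_integralZl//=; last 2 first.
- by apply/measurable_EFinP; apply: measurable_sum => i; exact: measurable_sum.
- by move=> t _; rewrite lee_fin sum_sqr_ge0.
under eq_integral do rewrite WE.
rewrite integral_sum//; last by move=> i; exact: integrable_sum.
under eq_bigr do rewrite integral_sum//.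
apply: (@le_trans _ _ ((n%:R ^+ 4)^-1%:E *
    \sum_(i < n) \sum_(j < n) (3 * K ^+ 2 * n%:R)%:E)%E).
  rewrite lee_wpmul2l ?lee_fin ?invr_ge0 ?exprn_ge0//.
  by apply: lee_sum => i _; apply: lee_sum => j _; exact: integral_sqr_sum_le.
under eq_bigr do rewrite sumEFin.
rewrite sumEFin -EFinM lee_fin.
under eq_bigr do rewrite sumr_const card_ord.
rewrite sumr_const card_ord -[_ *+ n *+ n]mulr_natr -[_ *+ n]mulr_natr.
rewrite le_eqVlt; apply/orP; left; apply/eqP; field.
by rewrite gt_eqF.
Qed.

(** The bound is strengthened to 2 - 2/(M + 1) for the induction, since 1/(M + 1)^2 <= 2/(M + 1) -
    2/(M + 2). *)
Lemma sum_inv_squares_le M : \sum_(m < M) (m.+1%:R ^+ 2)^-1 <= 2 :> R.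
Proof.
suff : \sum_(m < M) (m.+1%:R ^+ 2)^-1 <= 2 - 2 / M.+1%:R :> R.
  move=> /le_trans; apply; rewrite gerBl divr_ge0//.
elim: M => [|M IH]; first by rewrite big_ord0 divr1 subrr.
rewrite big_ord_recr/=; apply: le_trans (lerD IH (lexx _)) _.
rewrite -subr_ge0.
have -> : 2 - 2 / M.+2%:R - (2 - 2 / M.+1%:R + (M.+1%:R ^+ 2)^-1) =
    M%:R / (M.+2%:R * M.+1%:R ^+ 2) :> R.
  rewrite -[M.+2%:R]natr1 -[M.+1%:R]natr1; field.
  by rewrite ?natr1 !pnatr_eq0.
by rewrite divr_ge0// mulr_ge0.
Qed.

(** Along n = (m + 1)^2 the expectations of [avg_sqr] are at most 3 K^2/(m + 1)^2, so the series [S]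
    has finite expectation and is almost surely finite. Its terms then tend to 0, and interpolation
    between squares covers all n. *)
Lemma ae_cvg_avg_abs :
  {ae P, forall t, avg_abs (a t) @ \oo --> (0 : R)}.
Proof.
have mQ n : measurable_fun setT (fun t => (avg_sqr (a t) n)%:E).
  apply/measurable_EFinP; apply: measurable_funM => //.
  apply: measurable_sum => i; apply: measurable_sum => j.
  by apply: measurable_funX; exact: measurable_sum.
pose S t := (\sum_(m <oo) (avg_sqr (a t) (m.+1 ^ 2))%:E)%E.
have S0 t : (0 <= S t)%E.
  by apply: nneseries_ge0 => m _ _; rewrite lee_fin avg_sqr_ge0.
have mS : measurable_fun setT S.
  apply: ge0_emeasurable_sum => // m t _ _.
  by rewrite lee_fin avg_sqr_ge0.
have intS : P.-integrable setT S.
  apply/integrableP; split => //.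
  under eq_integral do rewrite gee0_abs//.
  rewrite /S integral_nneseries//; last first.
    by move=> m t _; rewrite lee_fin avg_sqr_ge0.
  apply: (@le_lt_trans _ _ (3 * K ^+ 2 * 2)%:E); last exact: ltry.
  apply: lime_le.
    apply: is_cvg_nneseries => m _ _; apply: integral_ge0 => t _.
    by rewrite lee_fin avg_sqr_ge0.
  apply: nearW => M; rewrite big_mkord.
  apply: (@le_trans _ _ (\sum_(m < M) (3 * K ^+ 2 * (m.+1%:R ^+ 2)^-1)%:E)%E).
    apply: lee_sum => m _; apply: le_trans (integral_avg_sqr_le _ _) _.
      by rewrite expn_gt0.
    by rewrite natrX.
  rewrite sumEFin lee_fin -mulr_sumr ler_wpM2l ?sum_inv_squares_le//.
  by rewrite mulr_ge0 ?sqr_ge0.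
have := integrable_ae measurableT intS; apply: filterS => t /(_ I) St.
apply: cvg_avg_abs; apply: (cvg_avg_sqr _ K); first by move=> i j k; exact: phiK.
pose u m := avg_sqr (a t) (m.+1 ^ 2).
have u0 m : 0 <= u m by exact: avg_sqr_ge0.
apply: (@cvg_series_cvg_0 _ _ u).
apply: nondecreasing_is_cvgn.
  by apply/nondecreasing_series => m _ _.
exists (fine (S t)) => _ [M _ <-].
rewrite -lee_fin fineK// /series/= -sumEFin.
by apply: nneseries_lim_ge => m _; rewrite lee_fin.
Qed.

End triple_averages.

(** * Integrals of bounded functions against a probability measure *)

Section probability_Rintegral.
Context {d : measure_display} {S : measurableType d} {R : realType}.
Variable F : probability S R.

Lemma EFin_prob_Rintegral (f : S -> R) (K : R) : measurable_fun setT f ->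
  (forall y, `|f y| <= K) -> (\int[F]_y (f y)%:E = (Rintegral F setT f)%:E)%E.
Proof.
move=> mf fK; rewrite /Rintegral fineK//.
apply: integrable_fin_num => //.
exact: (probability_bounded_integrable _ _ _ _ K).
Qed.

Lemma prob_Rintegral_bound (f : S -> R) (K : R) : measurable_fun setT f ->
  (forall y, `|f y| <= K) -> `|Rintegral F setT f| <= K.
Proof.
move=> mf fK.
have fint := probability_bounded_integrable _ _ F _ K mf fK.
apply: (le_trans (le_normr_Rintegral _ fint)) => //.
apply: (@le_trans _ _ (Rintegral F setT (fun=> K))).
  apply: le_Rintegral => //.
  - apply: (probability_bounded_integrable _ _ _ _ K); last by move=> x; rewrite normr_id.
    exact: measurableT_comp.
  - exact: (probability_bounded_integrable _ _ _ _ `|K|).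
by rewrite Rintegral_cst// [X in fine X]probability_setT mulr1.
Qed.

Lemma integral_centered (f : S -> R) (K : R) : measurable_fun setT f ->
  (forall y, `|f y| <= K) -> (\int[F]_y (f y - Rintegral F setT f)%:E = 0)%E.
Proof.
move=> mf fK.
under eq_integral do rewrite EFinB.
rewrite integralB_EFin//.
- rewrite (EFin_prob_Rintegral _ K)// integral_cst//.
  by rewrite [X in (_ * X)%E]probability_setT mule1 subee.
- exact: (probability_bounded_integrable _ _ _ _ K).
- exact: (probability_bounded_integrable _ _ _ _ `|Rintegral F setT f|).
Qed.

(** Positive and negative parts are treated separately, as Tonelli's measurability statement
    concerns nonnegative functions. *)
Lemma measurable_section_Rintegral d' (U : measurableType d') (h : U * S -> R) :
  measurable_fun setT h ->
  measurable_fun setT (fun x => Rintegral F setT (fun y => h (x, y))).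
Proof.
move=> mh; rewrite /Rintegral.
have mf : measurable_fun setT (fun x => (\int[F]_y (h (x, y))%:E)%E).
  pose f z := (h z)%:E.
  have mf : measurable_fun setT f by exact/measurable_EFinP.
  have -> : (fun x => (\int[F]_y (h (x, y))%:E)%E) =
     (fun x => (\int[F]_y (f^\+ (x, y)) - \int[F]_y (f^\- (x, y)))%E).
    apply/funext => x; rewrite integralE.
    by congr (_ - _)%E; apply: eq_integral => y _; rewrite ?funeposE ?funenegE.
  apply: emeasurable_funB; apply: measurable_fun_fubini_tonelli_F => //.
    exact: measurable_funepos.
  exact: measurable_funeneg.
exact: measurableT_comp (fine_measurable measurableT) mf.
Qed.

End probability_Rintegral.

(** * Almost sure limits of averages over the sample *)

Section averages_limits.
Context {d : measure_display} {T : measurableType d} {R : realType}.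
Variables (P : probability T R) (X : nat -> {RV P >-> R}).
Hypothesis iidX : iid P (fun i => X i).
Local Notation F := (distribution P (X 0%N)).

Lemma ae_cvg_avg_abs_centered (h : R * R * R -> R) (K : R) :
  measurable_fun setT h -> (forall p, `|h p| <= K) ->
  {ae P, forall t, avg_abs (fun i j k => h (X i t, X j t, X k t) -
     Rintegral F setT (fun z => h (X i t, X j t, z))) @ \oo --> (0 : R)}.
Proof.
move=> mh hK.
have mhs xy : measurable_fun setT (fun z => h (xy, z)).
  by apply: (measurableT_comp mh); exact: pair1_measurable.
apply: (ae_cvg_avg_abs P X iidX (fun x y z => h (x, y, z) -
    Rintegral F setT (fun z => h (x, y, z))) (K + K)).
- apply: measurable_funB.
    rewrite (_ : (fun p => _) = h)//.
    by apply/funext => -[[x y] z].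
  rewrite (_ : (fun p => _) = (fun xy => Rintegral F setT (fun z => h (xy, z))) \o fst).
    exact: measurableT_comp (measurable_section_Rintegral F _ _ h mh) measurable_fst.
  by apply/funext => -[[x y] z].
- move=> x y z; apply: le_trans (ler_normB _ _) _.
  by rewrite lerD// prob_Rintegral_bound.
- by move=> x y; apply: (integral_centered F _ K).
Qed.

(** The kernel (x, y, z) -> g(z) gives an array constant in i and j, so [avg_abs] reduces to the
    distance between the empirical mean of g and its integral. *)
Lemma ae_strong_law (g : R -> R) (K : R) :
  measurable_fun setT g -> (forall x, `|g x| <= K) ->
  {ae P, forall t, (fun n => n%:R^-1 * \sum_(i < n) g (X i t)) @ \oo -->
     Rintegral F setT g}.
Proof.
move=> mg gK.
have := ae_cvg_avg_abs_centered (fun p => g p.2) K.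
move=> /(_ (measurableT_comp mg measurable_snd) (fun p => gK p.2)).
apply: filterS => t /cvgrPdist_lt h; apply/cvgrPdist_lt => e e0.
have [N _ hN] := h e e0.
(* Taking [N.+1] ensures n > 0, so that n can be cancelled. *)
exists N.+1 => // n /= Nn; have := hN n (ltnW Nn).
have n0 : (0 < n)%N by exact: leq_trans Nn.
have nr0 : n%:R != 0 :> R by rewrite pnatr_eq0 -lt0n.
rewrite /avg_abs/= sub0r normrN.
under eq_bigr do rewrite sumr_const card_ord.
rewrite sumr_const card_ord.
set v := `|_^-1 * \sum_(_ < _) _|.
rewrite -[v *+ n *+ n]mulr_natr -[v *+ n]mulr_natr.
have -> : (n%:R ^+ 2)^-1 * (v * n%:R * n%:R) = v by field.
rewrite normr_id /v.
set c := Rintegral _ _ _.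
rewrite sumrB sumr_const card_ord mulrBr -[c *+ n]mulr_natl mulrA mulVf// mul1r.
by rewrite distrC.
Qed.

End averages_limits.

(** * Degrees and triangles *)

Section graph_counts.
Context {R : realType}.
Variables (fc : R -> R -> R) (B : set R).
Hypothesis fcC : forall x y, fc x y = fc y x.
Variables (x : nat -> R) (n i : nat).
Hypothesis ni : (i < n)%N.

Local Notation A j k := (adj fc B (x j) (x k)).
(** The summand of the kernel average of [hT]: no distinctness is imposed on j and k, and [adj] may
    hold on the diagonal. The sums of [u] and the triangle counts thus differ by terms with
    coinciding indices. *)
Let u j k : bool := [&& A i j, A j k & A k i].
Let D := degree fc B n x i.
Let Tr := triangles fc B n x i.

Lemma adjC y z : adj fc B y z = adj fc B z y.
Proof. by rewrite /adj fcC. Qed.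

Let uC j k : u j k = u k j.
Proof.
rewrite /u (adjC (x j) (x k)) (adjC (x i) (x j)) (adjC (x k) (x i)).
by case: (A j i); case: (A k j); case: (A i k).
Qed.

(** The sum over j < k and its copy with j and k exchanged together cover all j != k, since [u] is
    symmetric. *)
Lemma double_triangles : (2 * Tr =
  \sum_(j < n) \sum_(k < n) [&& (j : nat) != i, (k : nat) != i & j != k] * u j k)%N.
Proof.
have TrE : Tr = (\sum_(j < n) \sum_(k < n)
    [&& (j : nat) != i, (k : nat) != i & (j < k)%N] * u j k)%N.
  apply: eq_bigr => j _; rewrite big_mkcond; apply: eq_bigr => k _.
  by rewrite -/(u j k); case: ifP; rewrite ?mul1n ?mul0n.
rewrite mul2n -addnn {2}TrE exchange_big/= TrE -big_split/=.
apply: eq_bigr => j _; rewrite -big_split/=; apply: eq_bigr => k _.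
rewrite (uC k j) -mulnDl; congr (_ * _)%N.
rewrite -val_eqE/=; case: (_ != i); case: (_ != i) => //=.
by case: ltngtP.
Qed.

(** This is 2 Tr <= D (D - 1), free of natural subtraction: the ordered pairs of distinct neighbours
    and the D diagonal pairs make up D * D. *)
Lemma double_triangles_le : (2 * Tr + D <= D * D)%N.
Proof.
have DE : D = (\sum_(j < n) ((j : nat) != i) * A i j)%N.
  rewrite /D /degree big_mkcond; apply: eq_bigr => j _.
  by case: ifP; rewrite ?mul1n ?mul0n.
rewrite double_triangles {1}DE -big_split/= {1}DE big_distrl/=.
apply: leq_sum => j _.
(* The degree term for j is spread over k as the diagonal k = j, so that the comparison becomes
   termwise. *)
rewrite [X in (_ + X <= _)%N](_ : _ =
    \sum_(k < n) (k == j :> nat) * (((j : nat) != i) * A i j))%N.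
  rewrite -big_split/= {1}DE big_distrr/=; apply: leq_sum => k _.
  rewrite /u -val_eqE/= (adjC (x k) (x i)) (eq_sym (k : nat) j).
  case: (eqVneq (j : nat) k) => [->|_]; first by case: (_ != i) => //=; case: (A i k).
  by case: (_ != i) => //=; case: (_ != i) => //=; case: (A i j); case: (A i k); case: (A j k).
rewrite -big_distrl/= (bigD1 j)//= eqxx big1 ?mul1n//.
by move=> k; rewrite -val_eqE => /negbTE ->.
Qed.

(** The surplus comes from the pairs with j = i, k = i or j = k, at most n of each kind. *)
Lemma double_triangles_sandwich :
  (2 * Tr <= \sum_(j < n) \sum_(k < n) u j k <= 2 * Tr + 3 * n)%N.
Proof.
rewrite double_triangles; apply/andP; split.
  apply: leq_sum => j _; apply: leq_sum => k _.
  by case: (u j k); rewrite ?muln0// muln1 leq_b1.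
rewrite mulSn mulSn mul1n.
have s1 : (\sum_(j < n) \sum_(k < n) ((j : nat) == i) <= n)%N.
  rewrite exchange_big/=; apply: (@leq_trans (\sum_(k < n) 1)).
  2: by rewrite sum1_card card_ord.
  by apply: leq_sum => k _; exact: sum_nat_eq.
have s2 : (\sum_(j < n) \sum_(k < n) ((k : nat) == i) <= n)%N.
  apply: (@leq_trans (\sum_(k < n) 1)); last by rewrite sum1_card card_ord.
  by apply: leq_sum => k _; exact: sum_nat_eq.
have s3 : (\sum_(j < n) \sum_(k < n) ((k : nat) == j) <= n)%N.
  apply: (@leq_trans (\sum_(k < n) 1)); last by rewrite sum1_card card_ord.
  by apply: leq_sum => k _; exact: sum_nat_eq.
apply: leq_trans (leq_add (leqnn _) (leq_add s1 (leq_add s2 s3))).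
rewrite -!big_split/=; apply: leq_sum => j _.
rewrite -!big_split/=; apply: leq_sum => k _.
rewrite -val_eqE/= (eq_sym (k : nat) j).
case: (u j k); rewrite ?muln0// muln1.
by case: (_ == i); case: (_ == i); case: (_ == _).
Qed.

(** The two counts can differ only by a loop at i. *)
Lemma degree_sandwich : (D <= \sum_(j < n) A i j <= D + 1)%N.
Proof.
rewrite (bigID (fun j : 'I_n => (j : nat) != i))/= -/(degree fc B n x i) leq_addr/=.
by rewrite leq_add2l (big_pred1 (Ordinal ni)) ?leq_b1// => j; rewrite /= negbK.
Qed.

Lemma degree_le : (D <= n)%N.
Proof.
rewrite /D /degree big_mkcond/= (@leq_trans (\sum_(j < n) 1))//.
  by apply: leq_sum => j _; case: ifP => // _; exact: leq_b1.
by rewrite sum1_card card_ord.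
Qed.

Lemma sum_hD : \sum_(j < n) hD fc B (x i) (x j) = (\sum_(j < n) A i j)%:R :> R.
Proof. by rewrite natr_sum. Qed.

Lemma sum_hT : \sum_(j < n) \sum_(k < n) hT fc B (x i) (x j) (x k) =
  (\sum_(j < n) \sum_(k < n) u j k)%:R :> R.
Proof.
rewrite natr_sum; apply: eq_bigr => j _; rewrite natr_sum; apply: eq_bigr => k _.
by rewrite /hT -!natrM !mulnb /u andbA.
Qed.

Variable w : R.
Let r := local_cc fc B w n x i.

(** Stated without division so as to hold for every degree: for D = 0 or 1 both sides are 0,
    [double_triangles_le] forcing Tr = 0. *)
Lemma local_cc_identity : r * (D%:R * (D%:R - 1)) = (2 * Tr)%:R.
Proof.
have := double_triangles_le; rewrite /r /local_cc -/D -/Tr.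
case: ltnP => D2 TD.
  have -> : (D \in [:: 0; 1]) = false by rewrite !inE; case: (D) D2 => // -[].
  have -> : (D%:R * (D%:R - 1)) = 2 * 'C(D, 2)%:R :> R.
    have D0 : (0 < D)%N by exact: ltnW.
    by rewrite -natrM double_bin2 natrM -{2}(prednK D0) -natr1 addrK.
  have C0 : 'C(D, 2)%:R != 0 :> R by rewrite pnatr_eq0 -lt0n bin_gt0.
  by rewrite natrM mulr1 mulr0 addr0; field.
have [-> ->] : Tr = 0%N /\ (D%:R * (D%:R - 1)) = 0 :> R.
  case: (D) D2 TD => [_|[_|//]]; first by rewrite mul0r => TD; split=> //; lia.
  by rewrite subrr mulr0 => TD; split=> //; lia.
by rewrite mulr0.
Qed.

Lemma local_cc_bound : `|r| <= 1 + `|w|.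
Proof.
have := double_triangles_le; rewrite /r /local_cc -/D -/Tr.
case: ltnP => D2 TD.
  have -> : (D \in [:: 0; 1]) = false by rewrite !inE; case: (D) D2 => // -[].
  rewrite mulr0 addr0 mulr1 ler_wpDr// ger0_norm ?divr_ge0//.
  rewrite ler_pdivrMr ?ltr0n ?bin_gt0// mul1r ler_nat.
  rewrite -(leq_pmul2l (isT : 0 < 2)%N) double_bin2; move: TD.
  by case: (D) D2 => // D' _; rewrite mulnS [D'.+1.-1]/=; lia.
rewrite mulr0 add0r; case: (_ \in _); rewrite ?mulr1 ?mulr0 ?normr0 ?ler_wpDl//.
Qed.

(** In the application [e], [tau] and [rho] are the values of [ED], [ET] and [C1] at [x i].
    Multiplying by e^2 turns the comparison of two quotients into errors in the degree and triangle
    averages; the lower bound [delta] on [e] later allows dividing back. *)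
Lemma local_cc_deviation (e tau rho delta : R) :
  0 < delta -> delta <= e -> e <= 1 -> rho * e ^+ 2 = tau ->
  `|r - rho| * delta ^+ 2 <=
   (1 + `|w|) * (2 * `|n%:R^-1 * \sum_(j < n) hD fc B (x i) (x j) - e|)
   + `|(n%:R ^+ 2)^-1 * (\sum_(j < n) \sum_(k < n) hT fc B (x i) (x j) (x k)) - tau|
   + 6 * (1 + `|w|) * n%:R^-1.
Proof.
move=> delta0 deltae e1 rhoE.
have n0 : (0 < n)%N by exact: leq_ltn_trans ni.
have nr0 : 0 < n%:R :> R by rewrite ltr0n.
have nV0 : 0 < n%:R^-1 :> R by rewrite invr_gt0.
set D' := \sum_(j < n) hD _ _ _ _.
set T' := \sum_(j < n) \sum_(k < n) hT _ _ _ _ _.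
pose b : R := D%:R / n%:R.
have e0 : 0 < e by exact: lt_le_trans deltae.
have b0 : 0 <= b by rewrite divr_ge0.
have b1 : b <= 1 by rewrite ler_pdivrMr// mul1r ler_nat degree_le.
have D'b : `|n%:R^-1 * D' - b| <= n%:R^-1.
  rewrite /b mulrC -mulrBl normrM (gtr0_norm nV0) ler_piMl ?(ltW nV0)//.
  have /andP[Dl Du] := degree_sandwich.
  rewrite /D' sum_hD ger0_norm ?subr_ge0 ?ler_nat//.
  by rewrite lerBlDl -[X in _ + X]/(1%:R) -natrD ler_nat.
have T'b : `|(n%:R ^+ 2)^-1 * T' - (n%:R ^+ 2)^-1 * (2 * Tr)%:R| <= 3 * n%:R^-1.
  rewrite -mulrBr normrM ger0_norm ?invr_ge0 ?exprn_ge0//.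
  rewrite ler_pdivrMl ?exprn_gt0//.
  have /andP[Tl Tu] := double_triangles_sandwich.
  rewrite /T' sum_hT ger0_norm ?subr_ge0 ?ler_nat//.
  rewrite (_ : _ * (3 / n%:R) = (3 * n)%:R); last by rewrite natrM; field; rewrite gt_eqF.
  by rewrite lerBlDl -natrD ler_nat.
pose kap := 1 + `|w|.
have kap1 : 1 <= kap by rewrite lerDl.
have rkap : `|r| <= kap by exact: local_cc_bound.
(* from r D (D - 1) = 2 Tr and rho e^2 = tau, with b = D / n *)
have key : (r - rho) * e ^+ 2 = r * ((e - b) * (e + b)) + r * b * n%:R^-1 +
    ((n%:R ^+ 2)^-1 * (2 * Tr)%:R - tau).
  rewrite -rhoE -local_cc_identity /b; field; rewrite gt_eqF//.
have eb : `|e - b| <= `|n%:R^-1 * D' - e| + n%:R^-1.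
  rewrite distrC (_ : b - e = - (n%:R^-1 * D' - b) + (n%:R^-1 * D' - e)); last by ring.
  by rewrite (le_trans (ler_normD _ _))// normrN addrC lerD2l.
have d2 : delta ^+ 2 <= e ^+ 2 by rewrite lerXn2r ?nnegrE ?(ltW e0) ?(ltW delta0).
apply: (@le_trans _ _ (`|(r - rho) * e ^+ 2|)).
  by rewrite normrM (ger0_norm (sqr_ge0 e)) ler_wpM2l.
rewrite key.
have h1 : `|r * ((e - b) * (e + b))| <= kap * (2 * (`|n%:R^-1 * D' - e| + n%:R^-1)).
  rewrite normrM ler_pM// normrM mulrC ler_pM//.
  by rewrite ger0_norm ?addr_ge0 ?(ltW e0)//; move: e1 b1; lra.
have h2 : `|r * b * n%:R^-1| <= kap * n%:R^-1.
  rewrite normrM [ `|r * b|]normrM (gtr0_norm nV0) ler_wpM2r ?(ltW nV0)// (ger0_norm b0).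
  by rewrite -[leRHS]mulr1 ler_pM.
have h3 : `|(n%:R ^+ 2)^-1 * (2 * Tr)%:R - tau| <=
    3 * n%:R^-1 + `|(n%:R ^+ 2)^-1 * T' - tau|.
  set v := _ * (2 * Tr)%:R in T'b *.
  set v' := (n%:R ^+ 2)^-1 * T' in T'b *.
  rewrite (_ : v - tau = - (v' - v) + (v' - tau)); last by ring.
  by rewrite (le_trans (ler_normD _ _))// normrN lerD2r.
(* The errors of order 1/n add up to 6 kap/n: 2 from the loop at i in the degree sum, 1 from D (D -
   1) against D^2, and 3 from coinciding indices in the triangle sum. *)
have h4 : 3 * n%:R^-1 <= 3 * (kap * n%:R^-1) by rewrite ler_pM2l// ler_peMl ?(ltW nV0).
apply: le_trans (ler_normD _ _) _; apply: le_trans (lerD (ler_normD _ _) h3) _.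
move: (lerD h1 h2) h4; rewrite -/kap; nra.
Qed.

End graph_counts.

(** * The limiting coefficient *)

Section limit_coefficient.
Context {R : realType}.
Variables (fc : R -> R -> R) (B : set R) (w : R).
Hypothesis mfc : measurable_fun setT (fun p : R * R => fc p.1 p.2).
Hypothesis fcC : forall x y, fc x y = fc y x.
Hypothesis mB : measurable B.
Variable F : probability R R.

Local Notation hD := (hD fc B).
Local Notation hT := (hT fc B).
Local Notation ED := (ED fc B F).
Local Notation ET := (ET fc B F).
Local Notation C1 := (C1 fc B F w).

Lemma measurable_hD : measurable_fun setT (fun p : R * R => hD p.1 p.2).
Proof.
rewrite (_ : (fun p => _) = (\1_B : R -> R) \o (fun p : R * R => fc p.1 p.2)).
  exact: measurableT_comp (measurable_indic mB) mfc.
by apply/funext => p; rewrite /= indicE.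
Qed.

Lemma measurable_hD_comp d (S : measurableType d) (f g : S -> R) :
  measurable_fun setT f -> measurable_fun setT g ->
  measurable_fun setT (fun s => hD (f s) (g s)).
Proof.
move=> mf mg.
exact: (measurableT_comp measurable_hD (measurable_fun_pair mf mg)).
Qed.

Lemma measurable_hT : measurable_fun setT (fun p : R * R * R => hT p.1.1 p.1.2 p.2).
Proof.
have m11 : measurable_fun setT (fun p : R * R * R => p.1.1).
  exact: measurableT_comp measurable_fst measurable_fst.
have m12 : measurable_fun setT (fun p : R * R * R => p.1.2).
  exact: measurableT_comp measurable_snd measurable_fst.
have m2 : measurable_fun setT (fun p : R * R * R => p.2) by exact: measurable_snd.
apply: measurable_funM; last exact: measurable_hD_comp.
by apply: measurable_funM; exact: measurable_hD_comp.
Qed.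

Lemma hD_le1 x y : `|hD x y| <= 1.
Proof. by rewrite /hD normr_nat lern1 leq_b1. Qed.

Lemma hT_le1 x y z : `|hT x y z| <= 1.
Proof. by rewrite /hT -!natrM normr_nat lern1 !mulnb leq_b1. Qed.

Lemma hT_ge0 x y z : 0 <= hT x y z.
Proof. by rewrite /hT -!natrM ler0n. Qed.

Lemma hT_le_hD x y z : hT x y z <= hD x y * hD x z.
Proof.
rewrite /hT /hD (adjC _ _ fcC z x) -!natrM ler_nat !mulnb.
by case: adj => //=; case: adj => //=; case: adj.
Qed.

(** The probability that x, y and a random point of law [F] form a triangle; integrating it over y
    gives [ET]. *)
Definition pair_kernel x y : R := Rintegral F setT (fun z => hT x y z).

Let mhD x : measurable_fun setT (hD x).
Proof. by apply: measurable_hD_comp. Qed.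

Let mhT x y : measurable_fun setT (hT x y).
Proof. exact: measurableT_comp measurable_hT (pair1_measurable (x, y)). Qed.

Lemma measurable_pair_kernel :
  measurable_fun setT (fun p : R * R => pair_kernel p.1 p.2).
Proof.
rewrite (_ : (fun p => _) = (fun p => Rintegral F setT
  (fun z => (fun q : R * R * R => hT q.1.1 q.1.2 q.2) (p, z)))) //.
exact: measurable_section_Rintegral measurable_hT.
Qed.

Let mpk x : measurable_fun setT (pair_kernel x).
Proof. exact: measurableT_comp measurable_pair_kernel (pair1_measurable x). Qed.

Lemma pair_kernel_le1 x y : `|pair_kernel x y| <= 1.
Proof. by apply: prob_Rintegral_bound => // z; exact: hT_le1. Qed.

Lemma measurable_ED : measurable_fun setT ED.
Proof. exact: measurable_section_Rintegral measurable_hD. Qed.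

Lemma measurable_ET : measurable_fun setT ET.
Proof. exact: measurable_section_Rintegral measurable_pair_kernel. Qed.

Lemma ED_ge0 x : 0 <= ED x.
Proof. by apply: Rintegral_ge0 => y _; exact: ler0n. Qed.

Lemma ED_le1 x : ED x <= 1.
Proof.
apply: le_trans (ler_norm _) _.
by apply: prob_Rintegral_bound => // y; exact: hD_le1.
Qed.

Lemma ET_ge0 x : 0 <= ET x.
Proof. by do 2 (apply: Rintegral_ge0 => ? _); exact: hT_ge0. Qed.

Let intD x : F.-integrable setT (EFin \o hD x).
Proof. by apply: (probability_bounded_integrable _ _ _ _ 1) => // y; exact: hD_le1. Qed.

Lemma pair_kernel_le x y : pair_kernel x y <= hD x y * ED x.
Proof.
rewrite -RintegralZl//; apply: le_Rintegral => //.
- by apply: (probability_bounded_integrable _ _ _ _ 1) => // z; exact: hT_le1.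
- apply: (probability_bounded_integrable _ _ _ _ 1) => [|z].
    exact: measurable_funM.
  by rewrite normrM mulr_ile1 ?hD_le1.
- by move=> z _; exact: hT_le_hD.
Qed.

(** Forgetting the edge between y and z bounds h_T(x, y, z) by h_D(x, y) h_D(x, z), whose double
    integral is E_D(x)^2. Hence the quotient in [C1] is at most 1. *)
Lemma ET_le x : ET x <= ED x ^+ 2.
Proof.
rewrite expr2 -RintegralZr//; apply: (le_Rintegral (f1 := pair_kernel x)) => //.
- by apply: (probability_bounded_integrable _ _ _ _ 1) => // y; exact: pair_kernel_le1.
- apply: (probability_bounded_integrable _ _ _ _ 1) => [|z].
    exact: measurable_funM.
  by rewrite normrM mulr_ile1 ?hD_le1 ?ger0_norm ?ED_ge0 ?ED_le1.
- by move=> z _; exact: pair_kernel_le.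
Qed.

Lemma C1_degree0 x : ED x = 0 -> C1 x = w.
Proof. by move=> e0; rewrite /C1 e0 ltxx eqxx mulr0 mulr1 add0r. Qed.

Lemma C1_degree_gt0 x : 0 < ED x -> C1 x * ED x ^+ 2 = ET x.
Proof.
move=> e0; rewrite /C1 e0 gt_eqF// mulr1 mulr0 addr0 divfK//.
by rewrite expf_neq0// gt_eqF.
Qed.

Lemma C1_bound x : `|C1 x| <= 1 + `|w|.
Proof.
have := ED_ge0 x; rewrite le_eqVlt => /orP[/eqP/esym/C1_degree0 ->|e0].
  by rewrite lerDr.
rewrite /C1 e0 gt_eqF// mulr1 mulr0 addr0 ger0_norm ?divr_ge0 ?ET_ge0 ?sqr_ge0//.
by rewrite ler_wpDr// ler_pdivrMr ?exprn_gt0// mul1r ET_le.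
Qed.

Lemma measurable_bool_natr d (S : measurableType d) (b : S -> bool) :
  measurable_fun setT b -> measurable_fun setT (fun s => (b s)%:R : R).
Proof.
move=> mb; rewrite (_ : (fun s => _) = (fun s => if b s then 1 else 0)).
  exact: measurable_fun_ifT.
by apply/funext => s; case: (b s).
Qed.

Lemma measurable_C1 : measurable_fun setT C1.
Proof.
(* The reciprocal becomes a real power of exponent -1, a measurable function; the two agree for
   nonnegative arguments, 0 included. *)
rewrite (_ : C1 = fun x => ET x * (ED x ^+ 2) `^ (- 1) *
    ((0 < ED x)%R : bool)%:R + w * ((ED x == 0)%R : bool)%:R); last first.
  by apply/funext => x; rewrite powR_inv1 ?sqr_ge0.
have mE := measurable_ED.
apply: measurable_funD; apply: measurable_funM => //.
- apply: measurable_funM; first exact: measurable_ET.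
  by apply: (measurableT_comp (@measurable_powR R (-1))); exact: measurable_funX.
- by apply: measurable_bool_natr; exact: measurable_fun_ltr.
- by apply: measurable_bool_natr; exact: measurable_fun_eqr.
Qed.

(** The interval excludes 0: points with [ED] equal to 0 may carry positive mass and are handled
    exactly through isolation. *)
Definition low_degree (m : nat) : set R := ED @^-1` `]0, m.+1%:R^-1].

Lemma measurable_low_degree m : measurable (low_degree m).
Proof. by rewrite -[low_degree m]setTI; exact: measurable_ED. Qed.

(** The sets decrease to the empty set, so continuity from above applies. *)
Lemma cvg_low_degree :
  (fun m => Rintegral F setT (\1_(low_degree m))) @ \oo --> (0 : R).
Proof.
have F0 : F \o low_degree @ \oo --> 0%E.
  rewrite [X in _ --> X](_ : _ = F (\bigcap_m low_degree m)); last first.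
    rewrite (_ : \bigcap_m low_degree m = set0) ?measure0//.
    rewrite predeqE => x; split=> // xm.
    have := xm 0%N I; rewrite /low_degree/= in_itv/= => /andP[e0 _].
    (* An integer N above 1/E_D(x) puts x outside [low_degree N]. *)
    have /archi_boundP : 0 <= (ED x)^-1 by rewrite invr_ge0 ltW.
    set N := Num.bound _ => eN.
    have := xm N I; rewrite /low_degree/= in_itv/= => /andP[_].
    rewrite leNgt => /negP; apply.
    rewrite -[ltRHS]invrK ltf_pV2 ?posrE ?invr_gt0//.
    by rewrite (lt_le_trans eN)// ler_nat.
  apply: nonincreasing_cvg_mu.
  - by rewrite (le_lt_trans (probability_le1 _ _)) ?ltry//; exact: measurable_low_degree.
  - exact: measurable_low_degree.
  - by apply: bigcapT_measurable => m; exact: measurable_low_degree.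
  - move=> m n mn; apply/subsetPset => x; rewrite /low_degree/= !in_itv/=.
    move=> /andP[-> /le_trans]; apply.
    by rewrite lef_pV2 ?posrE// ler_nat.
rewrite (_ : (fun m => _) = fine \o (F \o low_degree)); first exact: fine_cvg F0.
apply/funext => m /=; rewrite /Rintegral integral_indic ?setIT//.
exact: measurable_low_degree.
Qed.

End limit_coefficient.

(** * Deterministic comparison of the global coefficient with the mean of [C1] *)

Section global_deviation.
Context {R : realType}.
Variables (fc : R -> R -> R) (B : set R) (w : R).
Hypothesis mfc : measurable_fun setT (fun p : R * R => fc p.1 p.2).
Hypothesis fcC : forall x y, fc x y = fc y x.
Hypothesis mB : measurable B.
Variable F : probability R R.

Local Notation hD := (hD fc B).
Local Notation hT := (hT fc B).
Local Notation ED := (ED fc B F).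
Local Notation ET := (ET fc B F).
Local Notation C1 := (C1 fc B F w).
Local Notation kap := (1 + `|w|).

(** All three deviations are arrays in i, j, k, constant in j when the kernel has two variables, so
    that one convergence result serves for each. The last two split the centring of [hT] by [ET]
    into two successive integrations. *)
Definition degree_deviation (x : nat -> R) (i j k : nat) : R :=
  hD (x i) (x k) - ED (x i).
Definition triangle_deviation (x : nat -> R) (i j k : nat) : R :=
  hT (x i) (x j) (x k) - pair_kernel fc B F (x i) (x j).
Definition pair_kernel_deviation (x : nat -> R) (i j k : nat) : R :=
  pair_kernel fc B F (x i) (x k) - ET (x i).

Variables (x : nat -> R) (n : nat).
Hypothesis isolated : forall i j, i != j -> ED (x i) = 0 -> ~~ adj fc B (x i) (x j).
Hypothesis n0 : (0 < n)%N.

Let nr0 : n%:R != 0 :> R. Proof. by rewrite pnatr_eq0 -lt0n. Qed.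

Lemma local_cc_isolated i : ED (x i) = 0 -> local_cc fc B w n x i = w.
Proof.
move=> e0; have d0 : degree fc B n x i = 0%N.
  by apply: big1 => j ji; rewrite (negbTE (isolated _ _ _ e0)) // eq_sym.
by rewrite /local_cc d0 mulr0 add0r mulr1.
Qed.

Let D' i := \sum_(k < n) hD (x i) (x k).
Let T' i := \sum_(j < n) \sum_(k < n) hT (x i) (x j) (x k).

(** Three cases: for E_D = 0 the difference vanishes by isolation; for 0 < E_D <= 1/(m + 1) the
    trivial bound 2 kap is charged to the indicator; otherwise [local_cc_deviation] with delta =
    1/(m + 1) gives the factor (m + 1)^2. *)
Lemma local_cc_C1_deviation m i : (i < n)%N ->
  `|local_cc fc B w n x i - C1 (x i)| <=
  2 * kap * \1_(low_degree fc B F m) (x i) +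
  m.+1%:R ^+ 2 * (2 * kap * `|n%:R^-1 * D' i - ED (x i)|
    + `|(n%:R ^+ 2)^-1 * T' i - ET (x i)| + 6 * kap * n%:R^-1).
Proof.
move=> ni.
have kap0 : 0 <= kap by rewrite addr_ge0.
set rhs2 := _ * (_ + _ + _).
have rhs20 : 0 <= rhs2.
  by rewrite mulr_ge0 ?exprn_ge0// !addr_ge0// !mulr_ge0// invr_ge0.
have := ED_ge0 fc B F (x i); rewrite le_eqVlt => /orP[/eqP/esym e0|e0].
  by rewrite local_cc_isolated// C1_degree0// subrr normr0 addr_ge0// !mulr_ge0// indicE.
have [em|me] := leP (ED (x i)) m.+1%:R^-1.
  rewrite indicE mem_set ?mulr1; last by rewrite /low_degree/= in_itv/= e0.
  rewrite ler_wpDr// (le_trans (ler_normB _ _))// mulr_natl mulr2n.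
  by rewrite lerD ?local_cc_bound ?C1_bound.
rewrite ler_wpDl ?mulr_ge0 ?indicE//.
have m0 : 0 < m.+1%:R^-1 :> R by rewrite invr_gt0.
have := local_cc_deviation fc B fcC x n i ni w (ED (x i)) (ET (x i)) (C1 (x i)) _
  m0 (ltW me) (ED_le1 fc B mfc mB F (x i)) (C1_degree_gt0 fc B w F (x i) e0).
rewrite -ler_pdivlMr ?exprn_gt0// exprVn invrK => /le_trans; apply.
by rewrite /rhs2 mulrC mulrA [kap * 2]mulrC.
Qed.

Lemma sum_avg_degree_deviation :
  n%:R^-1 * \sum_(i < n) `|n%:R^-1 * D' i - ED (x i)| = avg_abs (degree_deviation x) n.
Proof.
rewrite /avg_abs mulr_sumr [RHS]mulr_sumr; apply: eq_bigr => i _.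
rewrite /degree_deviation sumr_const sumrB sumr_const !card_ord.
set e := ED (x i); rewrite -[e *+ n]mulr_natl mulrBr [n%:R^-1 * (_ * e)]mulrA mulVf// mul1r.
by set v := `|_|; rewrite -[v *+ n]mulr_natl; field.
Qed.

(** Adding and subtracting the mean of the pair kernel over j writes each error as the mean over j
    of [N1 j + N2 j], where [N2] does not depend on j. *)
Lemma sum_avg_triangle_deviation :
  n%:R^-1 * \sum_(i < n) `|(n%:R ^+ 2)^-1 * T' i - ET (x i)| <=
  avg_abs (triangle_deviation x) n + avg_abs (pair_kernel_deviation x) n.
Proof.
rewrite /avg_abs -mulrDr -big_split/=.
rewrite (_ : (n%:R ^+ 2)^-1 = n%:R^-1 * n%:R^-1 :> R); last by rewrite expr2 invfM.
rewrite -[leRHS]mulrA ler_wpM2l ?invr_ge0// mulr_sumr; apply: ler_sum => i _.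
rewrite -big_split/=.
pose N1 j := n%:R^-1 * \sum_(k < n) triangle_deviation x i j k.
pose N2 j := n%:R^-1 * \sum_(k < n) pair_kernel_deviation x i j k.
have -> : n%:R^-1 * n%:R^-1 * T' i - ET (x i) = n%:R^-1 * \sum_(j < n) (N1 j + N2 j).
  pose g j := pair_kernel fc B F (x i) (x j).
  have -> : \sum_(j < n) (N1 j + N2 j) =
      n%:R^-1 * T' i - \sum_(j < n) g j + (\sum_(j < n) g j - n%:R * ET (x i)).
    rewrite big_split/=; congr (_ + _).
      rewrite /T' mulr_sumr -sumrB; apply: eq_bigr => j _.
      rewrite /N1 /triangle_deviation sumrB sumr_const card_ord -/(g j).
      by rewrite -[g j *+ n]mulr_natl mulrBr mulKf.
    rewrite /N2 /pair_kernel_deviation sumr_const card_ord sumrB sumr_const card_ord.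
    set e := ET (x i); rewrite -[e *+ n]mulr_natl mulrBr mulKf//.
    set v := _ - e; rewrite -[v *+ n]mulr_natl /v mulrBr mulVKf//.
  by rewrite addrA subrK mulrBr mulKf// mulrA.
rewrite normrM ger0_norm ?invr_ge0// ler_wpM2l ?invr_ge0//.
apply: (le_trans (ler_norm_sum _ (fun j : 'I_n => N1 j + N2 j) _)).
by apply: ler_sum => j _; exact: ler_normD.
Qed.

Lemma global_cc_deviation m :
  `|global_cc fc B w n x - n%:R^-1 * \sum_(i < n) C1 (x i)| <=
  2 * kap * (n%:R^-1 * \sum_(i < n) \1_(low_degree fc B F m) (x i)) +
  m.+1%:R ^+ 2 * (2 * kap * avg_abs (degree_deviation x) n +
    (avg_abs (triangle_deviation x) n + avg_abs (pair_kernel_deviation x) n)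
    + 6 * kap * n%:R^-1).
Proof.
rewrite /global_cc -mulrBr -sumrB normrM ger0_norm ?invr_ge0//.
apply: (@le_trans _ _ (n%:R^-1 * \sum_(i < n) (
  2 * kap * \1_(low_degree fc B F m) (x i) +
  m.+1%:R ^+ 2 * (2 * kap * `|n%:R^-1 * D' i - ED (x i)|
    + `|(n%:R ^+ 2)^-1 * T' i - ET (x i)| + 6 * kap * n%:R^-1)))).
  rewrite ler_wpM2l ?invr_ge0//.
  apply: (le_trans (ler_norm_sum _ (fun i : 'I_n => local_cc fc B w n x i - C1 (x i)) _)).
  by apply: ler_sum => i _; exact: local_cc_C1_deviation.
rewrite big_split/= -!mulr_sumr mulrDr mulrCA lerD2l mulrCA ler_wpM2l ?exprn_ge0//.
rewrite big_split/= mulrDr lerD//.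
  rewrite big_split/= -!mulr_sumr mulrDr mulrCA sum_avg_degree_deviation lerD2l.
  exact: sum_avg_triangle_deviation.
rewrite sumr_const card_ord; set v := 6 * kap / _.
by rewrite -[v *+ n]mulr_natl mulKf.
Qed.

End global_deviation.

(** * Almost sure isolation of vertices of zero expected degree *)

Section isolation.
Context {d : measure_display} {T : measurableType d} {R : realType}.
Variables (P : probability T R) (X : nat -> {RV P >-> R}).
Hypothesis iidX : iid P (fun i => X i).
Local Notation F := (distribution P (X 0%N)).
Variables (fc : R -> R -> R) (B : set R).
Hypothesis mfc : measurable_fun setT (fun p : R * R => fc p.1 p.2).
Hypothesis mB : measurable B.

(** The nonnegative variable I(E_D(X_i) = 0) h_D(X_i, X_j) has expectation 0: integrating out [X j]
    leaves E_D(X_i) on the event where it vanishes. Hence the variable is almost surely 0. *)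
Lemma ae_isolated i j : i != j ->
  {ae P, forall t, ED fc B F (X i t) = 0 -> ~~ adj fc B (X i t) (X j t)}.
Proof.
move=> ij; have [indX idX] := iidX.
pose b (p : R * R * R * R) : R :=
  (ED fc B F p.1.1.1 == 0)%:R * hD fc B p.1.1.1 p.2.
have m111 : measurable_fun setT (fun p : R * R * R * R => p.1.1.1).
  apply: measurableT_comp measurable_fst _.
  exact: measurableT_comp measurable_fst measurable_fst.
have mb : measurable_fun setT b.
  apply: measurable_funM; last first.
    exact: (measurable_hD_comp fc B mfc mB).
  apply: measurable_bool_natr; apply: measurable_fun_eqr => //.
  exact: measurableT_comp (measurable_ED fc B mfc mB F) m111.
have b0 p : 0 <= b p by rewrite mulr_ge0// /hD ler0n.
have bK p : `|b p| <= 1.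
  by rewrite ger0_norm// /b /hD -natrM mulnb lern1 leq_b1.
pose f t := (b (X i t, X i t, X i t, X j t))%:E.
have mf : measurable_fun setT f.
  apply/measurable_EFinP; apply: (measurableT_comp mb).
  by do 3 (apply: measurable_fun_pair => //).
have intb : (\int[P]_t `|f t| = 0)%E.
  under eq_integral do rewrite gee0_abs ?lee_fin//.
  rewrite /f (integral_triple_indep P X indX idX b 1 j i i i)//.
  apply: integral0_eq => t _; rewrite /b/=.
  have [e0|e0] := eqVneq (ED fc B F (X i t)) 0; last first.
    by apply: integral0_eq => y _; rewrite mul0r.
  under eq_integral do rewrite mul1r.
  rewrite (EFin_prob_Rintegral F _ 1) -/(ED fc B F (X i t)) ?e0//.
    exact: (measurable_hD_comp fc B mfc mB).
  by move=> y; exact: hD_le1.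
have := (ae_eq_integral_abs P measurableT mf).1 intb.
apply: filterS => t /(_ I); rewrite /f /b/= => -[] /[swap] e0.
by rewrite e0 eqxx mul1r /hD; case: adj => // /eqP; rewrite oner_eq0.
Qed.

End isolation.

(** * Almost sure convergence of the global coefficient *)

Lemma ae_and {d} {T : measurableType d} {R : realType} {P : probability T R}
    {A B : T -> Prop} :
  {ae P, forall t, A t} -> {ae P, forall t, B t} -> {ae P, forall t, A t /\ B t}.
Proof. exact: (@filterI _ _ (ae_filter_ringOfSetsType P)). Qed.

Theorem theorem3 (d : measure_display) (T : measurableType d) (R : realType)
  (P : probability T R) (X : nat -> {RV P >-> R})
  (fc : R -> R -> R) (B : set R) (w : R) :
  iid P (fun i => X i) ->
  measurable_fun setT (fun p : R * R => fc p.1 p.2) ->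
  (forall x y, fc x y = fc y x) ->
  measurable B ->
  {ae P, forall t,
    (fun n => (global_cc fc B w n (fun i => X i t))%:E) @ \oo -->
      (\int[P]_s (C1 fc B (distribution P (X 0%N)) w (X 0%N s))%:E)%E}.
Proof.
move=> iidX mfc fcC mB.
pose F := [the probability R R of distribution P (X 0%N)].
pose g := C1 fc B F w.
have mg : measurable_fun setT g by exact: measurable_C1.
have gK x : `|g x| <= 1 + `|w| by exact: C1_bound.
have -> : (\int[P]_s (g (X 0%N s))%:E = (Rintegral F setT g)%:E)%E.
  rewrite -(EFin_prob_Rintegral F g _ mg gK) integral_distribution//.
    exact/measurable_EFinP.
  apply: (probability_bounded_integrable _ _ P (g \o X 0%N) (1 + `|w|)) => [|t].
    exact: measurableT_comp.
  exact: gK.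
have mT := measurable_hT fc B mfc mB.
have mD := measurable_hD fc B mfc mB.
(* Dropping the middle variable turns a kernel of two variables into one of three, whose deviations
   are constant in j. *)
have m11 : measurable_fun setT (fun p : R * R * R => (p.1.1, p.2)).
  apply: measurable_fun_pair => //.
  exact: measurableT_comp measurable_fst measurable_fst.
have aeD := ae_cvg_avg_abs_centered P X iidX _ 1
  (measurableT_comp mD m11) (fun p => hD_le1 fc B p.1.1 p.2).
have aeT := ae_cvg_avg_abs_centered P X iidX _ 1
  mT (fun p => hT_le1 fc B p.1.1 p.1.2 p.2).
have aeG := ae_cvg_avg_abs_centered P X iidX _ 1
  (measurableT_comp (measurable_pair_kernel fc B mfc mB F) m11)
  (fun p => pair_kernel_le1 fc B mfc mB F p.1.1 p.2).
have aeS := ae_strong_law P X iidX g _ mg gK.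
(* Countably many almost sure events are intersected, so that m may be chosen after t and e. *)
have aeL : {ae P, forall t m, (fun n => n%:R^-1 *
    \sum_(i < n) \1_(low_degree fc B F m) (X i t)) @ \oo -->
    Rintegral F setT (\1_(low_degree fc B F m) : R -> R)}.
  apply: ae_foralln => m; apply: (ae_strong_law P X iidX _ 1) => [|x].
    exact: measurable_indic (measurable_low_degree fc B mfc mB F m).
  by rewrite indicE normr_nat lern1 leq_b1.
have aeI : {ae P, forall t, forall i j, i != j ->
    ED fc B F (X i t) = 0 -> ~~ adj fc B (X i t) (X j t)}.
  apply: ae_foralln => i; apply: ae_foralln => j.
  have [<-|ij] := eqVneq i j; first by apply: aeW => t /eqP.
  by have := ae_isolated P X iidX fc B mfc mB i j ij; apply: filterS => t + _.
have := ae_and (ae_and (ae_and aeD aeT) (ae_and aeG aeS))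
  (ae_and aeL aeI).
apply: filterS => t [[[cD cT] [cG cS]] [cL isolated]].
apply: cvg_EFin; first exact: nearW.
pose x i := X i t.
apply/cvgrPdist_lt => e e0.
pose kap : R := 1 + `|w|.
have kap0 : 0 < kap by rewrite ltr_pwDl.
(* With p below e/(8 kap), the low-degree term 2 kap p is below e/4. *)
have e8 : 0 < e / (8 * kap) by rewrite divr_gt0// mulr_gt0.
have [m _ mP] := (cvgrPdist_lt _ _).1 (cvg_low_degree fc B mfc mB F) _ e8.
have {mP} := mP m (leqnn m); rewrite sub0r normrN.
set p := Rintegral _ _ _ => /ltr_normlW pm.
(* With m fixed, (m + 1)^2 is a constant, and the strong-law error plus the bound of
   [global_cc_deviation] tends to 2 kap p as n grows. *)
have cvb : (fun n : nat => `|n%:R^-1 * (\sum_(i < n) g (x i)) - Rintegral F setT g| +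
    (2 * kap * (n%:R^-1 * \sum_(i < n) \1_(low_degree fc B F m) (x i)) +
     m.+1%:R ^+ 2 * (2 * kap * avg_abs (degree_deviation fc B F x) n +
      (avg_abs (triangle_deviation fc B F x) n + avg_abs (pair_kernel_deviation fc B F x) n)
      + 6 * kap * n%:R^-1))) @ \oo -->
    `|Rintegral F setT g - Rintegral F setT g| +
    (2 * kap * p + m.+1%:R ^+ 2 * (2 * kap * 0 + (0 + 0) + 6 * kap * 0)).
  apply: cvgD; first by apply: cvg_norm; apply: cvgB => //; exact: cvg_cst.
  apply: cvgD; first by apply: cvgMr; exact: cL.
  apply: cvgMr; apply: cvgD; first apply: cvgD.
  - by apply: cvgMr; exact: cD.
  - by apply: cvgD; [exact: cT|exact: cG].
  (* The harmonic sequence is 1/(n + 1), hence the shift. *)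
  - by apply: cvgMr; rewrite -cvg_shiftS; exact: cvg_harmonic.
have e2 : 0 < e / 2 by rewrite divr_gt0.
have [N _ hN] := (cvgrPdist_lt _ _).1 cvb _ e2.
exists N.+1 => // n /= Nn; have := hN n (ltnW Nn).
have n0 : (0 < n)%N by exact: leq_trans Nn.
rewrite subrr normr0 !mulr0 !addr0 mulr0 add0r addr0 distrC => /ltr_normlW.
set bound := _ + (_ + _) => hb.
have hp : 2 * kap * p < e / 2.
  apply: (@lt_trans _ _ (2 * kap * (e / (8 * kap)))).
    by rewrite ltr_pM2l// mulr_gt0.
  rewrite (_ : 2 * kap * (e / (8 * kap)) = e / 4); last by field; rewrite gt_eqF.
  by lra.
apply: (@le_lt_trans _ _ bound); last by move: hb hp; lra.
rewrite distrC -(subrKA (n%:R^-1 * \sum_(i < n) g (x i))) addrC.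
apply: le_trans (ler_normD _ _) _; rewrite lerD2l.
exact: (global_cc_deviation fc B w mfc fcC mB F x n isolated n0 m).
Qed.
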